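(* Let $C$ be a compact convex set, let $d_h$ be the Bregman divergence generated by a differentiable convex function $h$ on $C$, and let $f$ be a function on $C$ that is $(\sigma,L)$-strongly Bregman convex with respect to $d_h$, where $0<\sigma\le L$. Let $\mathbf{x}^0\in\mathrm{rint}(C)$ and let $\mathbf{x}^1,\mathbf{x}^2,\dots$ be generated by the mirror descent rule $$\mathbf{x}^{t+1}\in\arg\min_{\mathbf{y}\in C}\left\{\langle\nabla f(\mathbf{x}^t),\mathbf{y}-\mathbf{x}^t\rangle+L\cdot d_h(\mathbf{y},\mathbf{x}^t)\right\}.$$ Let $\mathbf{x}^*$ be a minimizer of $f$ over $C$. Then for all $t\ge 1$, $$f(\mathbf{x}^t)-f(\mathbf{x}^* )\;\le\;\frac{\sigma}{\left(\frac{L}{L-\sigma}\right)^t-1}\cdot d_h(\mathbf{x}^*,\mathbf{x}^0)$$ (when $\sigma=L$ the factor $\frac{\sigma}{(L/(L-\sigma))^t-1}$ is read as $0$).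
   Context: $\mathrm{rint}(C)$ is the relative interior of $C\subset\mathbb{R}^N$. The Bregman divergence generated by $h$ is $d_h(\mathbf{x},\mathbf{y})=h(\mathbf{x})-h(\mathbf{y})-\langle\nabla h(\mathbf{y}),\mathbf{x}-\mathbf{y}\rangle$ for $\mathbf{x}\in C$, $\mathbf{y}\in\mathrm{rint}(C)$; $f$ and $h$ are differentiable at points of $\mathrm{rint}(C)$. It is understood that the iterates $\mathbf{x}^t$ exist and lie in $\mathrm{rint}(C)$, so that the rule is well defined. Definition: $f$ is $(\sigma,L)$-strongly Bregman convex with respect to $d_h$ if $0<\sigma\le L$ and for all $\mathbf{y}\in\mathrm{rint}(C)$, $\mathbf{x}\in C$, $$f(\mathbf{y})+\langle\nabla f(\mathbf{y}),\mathbf{x}-\mathbf{y}\rangle+\sigma d_h(\mathbf{x},\mathbf{y})\le f(\mathbf{x})\le f(\mathbf{y})+\langle\nabla f(\mathbf{y}),\mathbf{x}-\mathbf{y}\rangle+L\, d_h(\mathbf{x},\mathbf{y}).$$ *)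

(* Defs.v *)
From HB Require Import structures.
From mathcomp Require Import all_boot all_order all_algebra.
From mathcomp Require Import all_classical all_reals all_analysis.

Set Implicit Arguments.
Unset Strict Implicit.
Unset Printing Implicit Defensive.

Import Order.TTheory GRing.Theory Num.Theory.
Import numFieldNormedType.Exports.

Local Open Scope classical_set_scope.
Local Open Scope ring_scope.

Section Defs.
Context {R : realType} {N : nat}.
Local Notation E := 'rV[R]_N.
Implicit Types (C : set E) (f h phi : E -> R) (x y g : E).

Definition dotp x y : R := \sum_(i < N) x ord0 i * y ord0 i.

Definition affine_hull C : set E :=
  [set z | exists (n : nat) (a : 'I_n -> R) (p : 'I_n -> E),
    [/\ forall i, C (p i), \sum_i a i = 1 & z = \sum_i a i *: p i]].

Definition rint C : set E :=
  [set x | C x /\ \forall z \near x, affine_hull C z -> C z].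

(* Functions "on C" are total functions whose values outside C are never used:
   differentiability at y is taken relative to C, so that C may have empty
   interior.  If f is differentiable at y in R^N, its usual gradient is a
   gradient in this sense. *)
Definition is_gradient C f y g : Prop :=
  forall x, f x = f y + dotp g (x - y) +o_(x \near within C (nbhs y)) (x - y).

Definition differentiable_in C f y : Prop := exists g, is_gradient C f y g.

(* At y in rint C, two gradients relative to C differ by a vector orthogonal to
   x - y for every x in C, so the products dotp (grad C f y) (x - y) do not
   depend on the choice made here. *)
Definition grad C f y : E := xget 0 [set g | is_gradient C f y g].

Definition bregman C h x y : R := h x - h y - dotp (grad C h y) (x - y).

Definition strongly_bregman_convex C h f (sigma L : R) : Prop :=
  0 < sigma <= L /\
  forall y x, rint C y -> C x ->
    f y + dotp (grad C f y) (x - y) + sigma * bregman C h x y <= f x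
      <= f y + dotp (grad C f y) (x - y) + L * bregman C h x y.

Definition argmin C phi : set E :=
  [set x | C x /\ forall y, C y -> phi x <= phi y].

Definition mirror_descent C h f (L : R) (x : nat -> E) : Prop :=
  forall t, x t.+1 \in argmin C (fun y =>
    dotp (grad C f (x t)) (y - x t) + L * bregman C h y (x t)).

(* The case sigma = L must be separated: division by zero yields 0 in the
   library, so L / (L - sigma) would not stand for +oo. *)
Definition rate (sigma L : R) (t : nat) : R :=
  if sigma == L then 0 else sigma / ((L / (L - sigma)) ^+ t - 1).

End Defs.

(* Main.v *)
(** With D_t = d_h(x*, x^t) and delta_t = f(x^t) - f(x* ), the first-order
    optimality condition of the mirror step and the three-point identity of the
    Bregman divergence give delta_(t+1) <= (L - sigma) D_t - L D_(t+1), and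
    delta is nonincreasing since x^t itself competes in the step.  Hence, with
    q = L / (L - sigma), the quantity (q^t - 1) delta_t + sigma q^t D_t does not
    increase with t; it equals sigma D_0 at t = 0, and D_t >= 0 by convexity
    of h. *)

Require Import Defs.
From mathcomp Require Import all_boot all_order all_algebra.
From mathcomp Require Import all_classical all_reals all_analysis.
From mathcomp Require Import ring lra.

Set Implicit Arguments.
Unset Strict Implicit.
Unset Printing Implicit Defensive.

Import Order.TTheory GRing.Theory Num.Theory.
Import numFieldNormedType.Exports.

Local Open Scope classical_set_scope.
Local Open Scope ring_scope.

Lemma dotpDr (R : realType) (N : nat) (g x y : 'rV[R]_N) :
  dotp g (x + y) = dotp g x + dotp g y.
Proof.
by rewrite -big_split; apply: eq_bigr => i _; rewrite !mxE mulrDr.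
Qed.

Lemma dotpZr (R : realType) (N : nat) (g x : 'rV[R]_N) (a : R) :
  dotp g (a *: x) = a * dotp g x.
Proof.
by rewrite mulr_sumr; apply: eq_bigr => i _; rewrite !mxE mulrCA.
Qed.

Lemma dotpNr (R : realType) (N : nat) (g x : 'rV[R]_N) :
  dotp g (- x) = - dotp g x.
Proof. by rewrite -scaleN1r dotpZr mulN1r. Qed.

Lemma dotpBr (R : realType) (N : nat) (g x y : 'rV[R]_N) :
  dotp g (x - y) = dotp g x - dotp g y.
Proof. by rewrite dotpDr dotpNr. Qed.

Lemma gradP (R : realType) (N : nat) (C : set 'rV[R]_N) (u : 'rV[R]_N -> R)
    (y : 'rV[R]_N) :
  differentiable_in C u y -> is_gradient C u y (grad C u y).
Proof. exact: xgetPex. Qed.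

Lemma bregman_three_point (R : realType) (N : nat) (C : set 'rV[R]_N)
    (h : 'rV[R]_N -> R) (x y z : 'rV[R]_N) :
  bregman C h x z = bregman C h x y + bregman C h y z
    + dotp (grad C h y) (x - y) - dotp (grad C h z) (x - y).
Proof. by rewrite /bregman !dotpBr; ring. Qed.

Lemma bregmanxx (R : realType) (N : nat) (C : set 'rV[R]_N)
    (h : 'rV[R]_N -> R) (x : 'rV[R]_N) : bregman C h x x = 0.
Proof. by rewrite /bregman dotpBr !subrr. Qed.

Lemma is_gradient_near (R : realType) (N : nat) (C : set 'rV[R]_N)
    (u : 'rV[R]_N -> R) (z g : 'rV[R]_N) (e : R) :
  is_gradient C u z g -> 0 < e ->
  exists2 r, 0 < r & forall w, C w -> `|w - z| < r ->
    `|u w - u z - dotp g (w - z)| <= e * `|w - z|.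
Proof.
move=> ug e0.
(* [funext] lifts the pointwise little-o to an equality of functions, which [eqaddoP] turns into an
   eventual bound at tolerance [e]; the filter [within C] becomes the premise [C w]. *)
have /funext/eqaddoP/(_ e e0)/nbhs_ballP[r /= r0 ball_r] := ug.
exists r => // w Cw wz.
have := ball_r w; rewrite -ball_normE /= distrC => /(_ wz Cw).
by rewrite !fctE opprD addrA.
Qed.

Lemma convex_set_segment (R : realType) (N : nat) (C : set 'rV[R]_N)
    (y z : 'rV[R]_N) (s : R) :
  convex_set C -> C y -> C z -> 0 <= s <= 1 -> C (z + s *: (y - z)).
Proof.
move=> cC Cy Cz /andP[s0 s1].
have := cC y z (Itv01 s0 s1); rewrite !inE => /(_ Cy Cz).
rewrite /conv /= /unstable.onem scalerBl scale1r.
by rewrite addrCA -scalerBr.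
Qed.

Lemma convex_function_segment (R : realType) (N : nat) (C : set 'rV[R]_N)
    (h : 'rV[R]_N -> R) (y z : 'rV[R]_N) (s : R) :
  convex_function C h -> C y -> C z -> 0 <= s <= 1 ->
  h (z + s *: (y - z)) - h z <= s * (h y - h z).
Proof.
move=> cC Cy Cz /andP[s0 s1].
have := cC (Itv01 s0 s1) y z; rewrite !inE => /(_ Cy Cz).
rewrite convRE /conv /= /unstable.onem scalerBl scale1r scalerBr addrCA.
lra.
Qed.

Lemma is_gradient_segment (R : realType) (N : nat) (C : set 'rV[R]_N)
    (u : 'rV[R]_N -> R) (y z g : 'rV[R]_N) (e : R) :
  convex_set C -> C y -> C z -> is_gradient C u z g -> 0 < e ->
  exists s : R, 0 < s <= 1 /\
    `|u (z + s *: (y - z)) - u z - s * dotp g (y - z)| <= e * s.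
Proof.
(* The summand 1 keeps [n] positive when [y = z]. The tolerance [e / n] absorbs the length of
   [y - z], and [s <= r / n] keeps the moved point within [r] of [z]. *)
move=> cC Cy Cz ug e0; set n := 1 + `|y - z|.
have n0 : 0 < n by rewrite ltr_pwDl.
have [r r0 ur] := is_gradient_near ug (divr_gt0 e0 n0).
set s := Num.min 1 (r / n); exists s.
have s0 : 0 < s by rewrite lt_min ltr01 divr_gt0.
have s1 : s <= 1 by rewrite ge_min lexx.
have wz : `|s *: (y - z)| < s * n.
  by rewrite normrZ gtr0_norm// ltr_pM2l// ltrDr.
have snr : s * n <= r by rewrite -ler_pdivlMr// ge_min lexx orbT.
rewrite s0 s1; split=> //.
have /ur : C (z + s *: (y - z)).
  by apply: convex_set_segment => //; rewrite (ltW s0).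
rewrite [z + _]addrC addrK dotpZr => /(_ (lt_le_trans wz snr))/le_trans; apply.
rewrite mulrAC ler_pdivrMr// -!mulrA ler_pM2l//.
exact: ltW.
Qed.

(** At each tolerance [e] a single short step suffices: its chord slope is at least [k] and within
    [e] of the directional derivative. Then [e] tends to 0. *)
Lemma is_gradient_slope_ge (R : realType) (N : nat) (C : set 'rV[R]_N)
    (u : 'rV[R]_N -> R) (y z g : 'rV[R]_N) (k : R) :
  convex_set C -> C y -> C z -> is_gradient C u z g ->
  (forall s, 0 < s <= 1 -> s * k <= u (z + s *: (y - z)) - u z) ->
  k <= dotp g (y - z).
Proof.
move=> cC Cy Cz ug ku; apply/ler_addgt0Pr => e e0.
have [s [s01]] := is_gradient_segment cC Cy Cz ug e0.
rewrite ler_norml => /andP[_ us]; have := ku s s01.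
case/andP: s01 => s0 _ ks; rewrite -(ler_pM2l s0); lra.
Qed.

Lemma is_gradient_slope_le (R : realType) (N : nat) (C : set 'rV[R]_N)
    (u : 'rV[R]_N -> R) (y z g : 'rV[R]_N) (k : R) :
  convex_set C -> C y -> C z -> is_gradient C u z g ->
  (forall s, 0 < s <= 1 -> u (z + s *: (y - z)) - u z <= s * k) ->
  dotp g (y - z) <= k.
Proof.
move=> cC Cy Cz ug ku; apply/ler_addgt0Pr => e e0.
have [s [s01]] := is_gradient_segment cC Cy Cz ug e0.
rewrite ler_norml => /andP[us _]; have := ku s s01.
case/andP: s01 => s0 _ ks; rewrite -(ler_pM2l s0); lra.
Qed.

Lemma bregman_ge0 (R : realType) (N : nat) (C : set 'rV[R]_N)
    (h : 'rV[R]_N -> R) (x y : 'rV[R]_N) :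
  convex_set C -> convex_function C h -> C x -> C y ->
  differentiable_in C h y -> 0 <= bregman C h x y.
Proof.
move=> cC ch Cx Cy /gradP hy; rewrite subr_ge0.
apply: (is_gradient_slope_le cC Cx Cy hy _) => s /andP[/ltW s0 s1].
by apply: (convex_function_segment ch Cx Cy _); rewrite s0.
Qed.

(** The objective is an affine function plus [L * h], so minimality of [z] along the segment towards
    [y] bounds the increments of [h] from below, and the bound passes to the derivative of [h] at
    [z]. *)
Lemma mirror_step_optimality (R : realType) (N : nat) (C : set 'rV[R]_N)
    (h : 'rV[R]_N -> R) (L : R) (g x z y : 'rV[R]_N) :
  convex_set C -> 0 < L -> differentiable_in C h z -> C y ->
  argmin C (fun w => dotp g (w - x) + L * bregman C h w x) z ->
  0 <= dotp g (y - z)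
       + L * (dotp (grad C h z) (y - z) - dotp (grad C h x) (y - z)).
Proof.
move=> cC L0 /gradP hz Cy [Cz zmin].
(* [- L * k] is the slope, in the direction [y - z], of the affine part of the objective. *)
set k := dotp (grad C h x) (y - z) - dotp g (y - z) / L.
have : k <= dotp (grad C h z) (y - z).
  apply: (is_gradient_slope_ge cC Cy Cz hz _) => s /andP[/ltW s0 s1].
  have /zmin : C (z + s *: (y - z)).
    by apply: (convex_set_segment cC Cy Cz _); rewrite s0.
  rewrite /bregman !(dotpBr, dotpDr, dotpZr) -(ler_pM2l L0) /k !dotpBr => le_z.
  rewrite [L * (s * _)](_ : _ = s * (L * (dotp (grad C h x) y
    - dotp (grad C h x) z) - (dotp g y - dotp g z))); first lra.
  by field; rewrite gt_eqF.
rewrite -(ler_pM2l L0) /k mulrBr mulrCA divff ?gt_eqF// mulr1; lra.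
Qed.

(** Subtract the lower bound for [f y] from the upper bound for [f z], both based at [x]. By
    optimality and the three-point identity, the remaining term [dotp (grad C f x) (z - y)] is at
    most [L] times d(y,x) - d(y,z) - d(z,x), and d(z,x) cancels. *)
Lemma mirror_step_gap (R : realType) (N : nat) (C : set 'rV[R]_N)
    (f h : 'rV[R]_N -> R) (sigma L : R) (x z y : 'rV[R]_N) :
  convex_set C -> differentiable_in C h z -> rint C x -> C y ->
  strongly_bregman_convex C h f sigma L ->
  argmin C (fun w => dotp (grad C f x) (w - x) + L * bregman C h w x) z ->
  f z - f y <= (L - sigma) * bregman C h y x - L * bregman C h y z.
Proof.
move=> cC hz Cx Cy [/andP[sigma0 sigmaL] f_sbc] zmin; have [Cz _] := zmin.
have /andP[_ fz] := f_sbc x z Cx Cz.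
have /andP[fy _] := f_sbc x y Cx Cy.
have L0 := lt_le_trans sigma0 sigmaL.
have := mirror_step_optimality cC L0 hz Cy zmin.
rewrite (bregman_three_point C h y z x) in fy *.
move: fy fz; rewrite !dotpBr; lra.
Qed.

(** The objective vanishes at [x], and by the upper bound in [f_sbc] its value at [z] is at least
    [f z - f x]. *)
Lemma mirror_step_descent (R : realType) (N : nat) (C : set 'rV[R]_N)
    (f h : 'rV[R]_N -> R) (sigma L : R) (x z : 'rV[R]_N) :
  rint C x -> strongly_bregman_convex C h f sigma L ->
  argmin C (fun w => dotp (grad C f x) (w - x) + L * bregman C h w x) z ->
  f z <= f x.
Proof.
move=> rx [_ f_sbc] [Cz zmin]; have [Cx _] := rx.
have /andP[_ fz] := f_sbc x z rx Cz.
by move: fz (zmin x Cx); rewrite bregmanxx !dotpBr; lra.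
Qed.

Lemma geometric_potential (R : realType) (sigma L : R) (a D : nat -> R) :
  0 < sigma < L ->
  (forall t, a t.+1 <= a t) ->
  (forall t, a t.+1 <= (L - sigma) * D t - L * D t.+1) ->
  let q := L / (L - sigma) in
  forall t, (q ^+ t - 1) * a t + sigma * q ^+ t * D t <= sigma * D 0%N.
Proof.
move=> /andP[sigma0 sigmaL] a_dec aD q; elim=> [|t IHt].
  by rewrite expr0 subrr mul0r add0r mulr1.
have Ls : 0 < L - sigma by rewrite subr_gt0.
have q1 : 1 <= q by rewrite ler_pdivlMr// mul1r; lra.
have qt1 : 1 <= q ^+ t by exact: exprn_ege1.
apply: le_trans IHt.
(* Since [q - 1 = sigma / (L - sigma)], the coefficient [q ^+ t.+1 - 1] splits into [q ^+ t - 1],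
   handled by monotonicity, and [q ^+ t * (sigma / (L - sigma))], handled by the gap inequality. *)
have dec : (q ^+ t - 1) * a t.+1 <= (q ^+ t - 1) * a t.
  by rewrite ler_wpM2l// subr_ge0.
have gap : q ^+ t * (sigma / (L - sigma)) * a t.+1 <=
    q ^+ t * (sigma / (L - sigma)) * ((L - sigma) * D t - L * D t.+1).
  rewrite ler_wpM2l// mulr_ge0 ?divr_ge0 ?(ltW sigma0) ?(ltW Ls)//.
  exact: le_trans qt1.
have -> : (q ^+ t.+1 - 1) * a t.+1 + sigma * q ^+ t.+1 * D t.+1 =
    (q ^+ t - 1) * a t.+1 + q ^+ t * (sigma / (L - sigma)) * a t.+1
    + q ^+ t * (sigma / (L - sigma)) * (L * D t.+1).
  (* Only the factors split off by [exprSr] are unfolded, so that [q ^+ t] stays an atom for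
     [field]. *)
  by rewrite exprSr {2 4}/q; field; rewrite gt_eqF.
have -> : sigma * q ^+ t * D t =
    q ^+ t * (sigma / (L - sigma)) * ((L - sigma) * D t).
  by field; rewrite gt_eqF.
lra.
Qed.

Theorem theorem3p1 (R : realType) (N : nat) (C : set 'rV[R]_N)
    (f h : 'rV[R]_N -> R) (sigma L : R)
    (x : nat -> 'rV[R]_N) (xstar : 'rV[R]_N)
    (C_compact : compact C) (C_convex : convex_set C)
    (h_convex : convex_function C h)
    (h_diff : forall y, rint C y -> differentiable_in C h y)
    (f_diff : forall y, rint C y -> differentiable_in C f y)
    (f_sbc : strongly_bregman_convex C h f sigma L)
    (x_rint : forall t, rint C (x t))
    (x_md : mirror_descent C h f L x)
    (xstar_min : xstar \in argmin C f)
    (t : nat) (t_ge1 : (1 <= t)%N) :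
  f (x t) - f xstar <= rate sigma L t * bregman C h xstar (x 0%N).
Proof.
have [Cxs _] : argmin C f xstar by rewrite inE in xstar_min.
have step n : argmin C (fun w => dotp (grad C f (x n)) (w - x n)
    + L * bregman C h w (x n)) (x n.+1) by have := x_md n; rewrite inE.
have [/andP[sigma0 sigmaL] _] := f_sbc.
have D0 n : 0 <= bregman C h xstar (x n).
  by apply: bregman_ge0 => //; [case: (x_rint n)|exact/h_diff].
have gap n : f (x n.+1) - f xstar <= (L - sigma) * bregman C h xstar (x n)
    - L * bregman C h xstar (x n.+1).
  by apply: (mirror_step_gap _ _ _ _ f_sbc (step n)) => //; exact/h_diff.
rewrite /rate; have [sL|sL] := eqVneq sigma L.
  (* With [sigma = L] the gap bound loses its first term, so a single step already reaches the
     minimum; [t_ge1] provides that step. *)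
  case: t t_ge1 => // n _; apply: le_trans (gap n) _.
  by rewrite sL subrr !mul0r sub0r oppr_le0 mulr_ge0// -sL ltW.
have sltL : sigma < L by rewrite lt_neqAle sL.
have Ls : 0 < L - sigma by rewrite subr_gt0.
have dec n : f (x n.+1) - f xstar <= f (x n) - f xstar.
  by rewrite lerD2r; exact: (mirror_step_descent (x_rint n) f_sbc (step n)).
have sigma_lt : 0 < sigma < L by rewrite sigma0.
have := geometric_potential sigma_lt dec gap t.
set q := L / (L - sigma) => /= pot.
have q1 : 1 < q by rewrite ltr_pdivlMr// mul1r; lra.
have qt1 : 0 < q ^+ t - 1 by rewrite subr_gt0 exprn_egt1// -lt0n.
(* Once the positive denominator is cleared, [pot] gives the bound after dropping its summand in
   [sigma * q ^+ t], which is nonnegative by [D0]. *)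
rewrite mulrAC ler_pdivlMr// mulrC (le_trans _ pot)// lerDl.
rewrite !mulr_ge0// ?(ltW sigma0)//.
by rewrite exprn_ge0// ltW// (lt_trans ltr01).
Qed.
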